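(* Let $K$ be a field and let $I \subseteq K[x,y,z]$ be a proper monomial ideal equigenerated in degree $d$. Then $$\mathrm{v}(\overline{I^k}) \le \mathrm{v}(I^k)$$ for all $k \ge 1$.
   Context: $K[x,y,z]$ is the standard graded polynomial ring in three variables. A monomial ideal is equigenerated in degree $d$ if all its minimal monomial generators have degree $d$. For a proper homogeneous ideal $I$ of a standard graded polynomial ring $R=K[x_1,\ldots,x_n]$, the v-number of $I$ is $$\mathrm{v}(I)=\min\{d\ge 0 : \text{there exist } f\in R_d \text{ and } \mathfrak p\in\operatorname{Ass}(I) \text{ such that } (I:f)=\mathfrak p\},$$ where $R_d$ is the space of homogeneous polynomials of degree $d$, $(I:f)=\{g\in R: gf\in I\}$, and $\operatorname{Ass}(I)$ is the set of associated primes of $R/I$. The integral closure $\overline{I}$ of an ideal $I$ is the ideal of all $x\in R$ satisfying an equation $x^m+a_1x^{m-1}+\cdots+a_m=0$ with $m\ge 1$ and $a_i\in I^i$. *)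

(* Defs.v *)
From HB Require Import structures.
From Stdlib Require Import ClassicalEpsilon.
From mathcomp Require Import all_boot all_order all_algebra ring_quotient.
From mathcomp Require Import boolp classical_sets.
From mathcomp Require Import mpoly.

Set Implicit Arguments.
Unset Strict Implicit.
Unset Printing Implicit Defensive.

Import GRing.Theory.
Local Open Scope classical_set_scope.
Local Open Scope ring_scope.

Section Ideals.
Variable R : comNzRingType.
Implicit Types (I P S : set R) (f : R).

Definition ideal_span S : set R :=
  [set f | exists s : seq (R * R),
     (forall c, c \in s -> S c.2) /\ f = \sum_(c <- s) c.1 * c.2].

Definition ideal_pow I (k : nat) : set R :=
  ideal_span [set f | exists g : 'I_k -> R,
                        (forall i, I (g i)) /\ f = \prod_(i < k) g i].

Definition colon I f : set R := [set g | I (g * f)].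

(* [idealr_closed] includes properness. *)
Definition prime_ideal P : Prop :=
  idealr_closed [pred x | x \in P] /\ prime_idealr_closed [pred x | x \in P].

(* The annihilator of the class of f in R / I is (I : f). *)
Definition Ass I : set (set R) :=
  [set P | prime_ideal P /\ exists f, colon I f = P].

Definition integral_closure I : set R :=
  [set x | exists (m : nat) (a : nat -> R),
     [/\ (0 < m)%N,
         forall i, (0 < i <= m)%N -> ideal_pow I i (a i) &
         x ^+ m + \sum_(1 <= i < m.+1) a i * x ^+ (m - i) = 0]].

End Ideals.

Section PolynomialIdeals.
Variables (n : nat) (K : fieldType).
Implicit Types (I : set {mpoly K[n]}) (G : set 'X_{1..n}).

Definition monomial_span G : set {mpoly K[n]} :=
  ideal_span [set 'X_[m] | m in G].

Definition monomial_ideal I : Prop := exists G, I = monomial_span G.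

(* An irredundant set of monomial generators; a monomial ideal has exactly
   one. *)
Definition minimal_monomial_generators I G : Prop :=
  I = monomial_span G /\
  forall G', G' `<=` G -> I = monomial_span G' -> G' = G.

(* Vacuous for the zero ideal, which is thus equigenerated in every degree. *)
Definition equigenerated (d : nat) I : Prop :=
  forall G, minimal_monomial_generators I G -> forall m, G m -> mdeg m = d.

Definition v_degrees I : set nat :=
  [set d | exists (f : {mpoly K[n]}) (P : set {mpoly K[n]}),
     [/\ f \is d.-homog, Ass I P & colon I f = P]].

Definition is_v_number I (d : nat) : Prop :=
  v_degrees I d /\ forall e, v_degrees I e -> (d <= e)%N.

(* The minimum of [v_degrees I]. It exists for every proper homogeneous ideal;
   the value is unspecified (not a chosen default) when there is none. *)
Definition v_number I : nat := epsilon (inhabits 0%N) (is_v_number I).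

End PolynomialIdeals.

(* Main.v *)
(** The ideal [J = I^k] is again generated by monomials of a single degree [D].
    A monomial ideal has a prime colon ideal by a form of degree [e] exactly when
    it has a colon ideal generated by variables by some monomial of degree [e],
    and this is a condition on exponents only. The monomials of the integral
    closure of [J] are those having a power [N > 0] divisible by a product of [N]
    generators.

    Every admissible degree [e] for [J] is at least [D - 1].
    - If a monomial [m] of degree [D - 1] is admissible for [J], it is so for the
      integral closure. The only case which is not a direct comparison of
      exponents is [(J : m) = (x, y)] with some [m z^b] integral over [J]. Then
      the exponents of [x m], of [y m], and of a product of [N] generators
      dividing [(m z^b)^N] have that of [z m] in their convex cone, so that the
      colon ideal becomes [(x, y, z)].
    - The integral closure always has an admissible degree at most [D]. This is
      clear if a variable divides all generators, or if all pure powers are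
      generators. Otherwise [(x, y)] contains [J] for some pair of variables;
      take generators [x^p z^(D-p)] and [y^q z^(D-q)] with [p] and [q] minimal
      and, say, [q <= p]: the colon ideal by [x^(p-1) z^(D-p+1)] is [(x, y)]. *)
Require Import Defs.
From HB Require Import structures.
From Stdlib Require Import ClassicalEpsilon.
From mathcomp Require Import all_boot all_order all_algebra.
From mathcomp Require Import boolp classical_sets.
From mathcomp Require Import mpoly zify.

Set Implicit Arguments.
Unset Strict Implicit.
Unset Printing Implicit Defensive.

Import Order.TTheory GRing.Theory.
Local Open Scope classical_set_scope.
Local Open Scope ring_scope.


(** * Integral dependence over a filtration, through the Rees algebra *)

Record filtration (R : comNzRingType) := Filtration {
  filt :> nat -> set R;
  filt0 : filt 0%N = setT;
  filtB : forall i x y, filt i x -> filt i y -> filt i (x - y);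
  filtM : forall i j x y, filt i x -> filt j y -> filt (i + j)%N (x * y);
  filt_zero : forall i, filt i 0 }.

Section Rees.
Variables (R : comNzRingType) (F : filtration R).

Definition rees_pred : {pred {poly R}} := fun p => `[< forall i, F i p`_i >].

Lemma rees_predP (p : {poly R}) : reflect (forall i, F i p`_i) (p \in rees_pred).
Proof. exact: asboolP. Qed.

Lemma filtD i x y : F i x -> F i y -> F i (x + y).
Proof.
move=> Fx Fy; rewrite -[y]opprK; apply: filtB => //.
by rewrite -sub0r; apply: filtB => //; apply: filt_zero.
Qed.

Lemma filt_sum (I : Type) (r : seq I) (P : pred I) (f : I -> R) i :
  (forall j, P j -> F i (f j)) -> F i (\sum_(j <- r | P j) f j).
Proof.
by move=> Ff; elim/big_ind: _ => //; [apply: filt_zero | apply: filtD].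
Qed.

Definition integral_filt (x : R) := exists (m : nat) (a : nat -> R),
  [/\ (0 < m)%N, forall i, (0 < i <= m)%N -> F i (a i) &
      x ^+ m + \sum_(1 <= i < m.+1) a i * x ^+ (m - i) = 0].

(* An equation of integral dependence for [x] over the filtration is the
   top-degree part of one for [x T] over the Rees algebra. *)
Lemma integral_filtE (A : comNzRingType) (iota : {rmorphism A -> {poly R}})
    (iotaP : forall p i, F i (iota p)`_i)
    (iota_onto : forall q : {poly R},
       (forall i, F i q`_i) -> exists p, iota p = q) (x : R) :
  integral_filt x <-> integralOver iota (x *: 'X).
Proof.
split=> [[m [a [m_gt0 Fa eqx]]] | [p p_monic]].
  have /choice [r iotar] i :
      exists p, (0 < i <= m)%N -> iota p = a i *: 'X^i.
    have [im | _] := boolP (0 < i <= m)%N; last by exists 0.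
    have [j | p <-] := iota_onto (a i *: 'X^i); last by exists p.
    rewrite coefZ coefXn; have [-> | _] := eqVneq j i.
      by rewrite mulr1; apply: Fa.
    by rewrite mulr0; apply: filt_zero.
  (* The given equation multiplied by [T^m]: the coefficient of index [j] in [q] lifts
     [a (m - j) T^(m - j)]. *)
  pose q := \poly_(j < m) r (m - j)%N.
  have szq : (size q < size ('X^m : {poly A}))%N.
    by rewrite size_polyXn ltnS size_poly.
  exists ('X^m + q); first by rewrite monicE lead_coefDl // lead_coefXn.
  rewrite /root rmorphD /= map_polyXn hornerD hornerXn.
  rewrite /q poly_def rmorph_sum horner_sum /=.
  rewrite (eq_bigr (fun i : 'I_m => (a (m - i)%N * x ^+ i) *: 'X^m)); last first.
    move=> i _; rewrite linearZ /= map_polyXn hornerZ hornerXn iotar; last first.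
      by rewrite subn_gt0 ltn_ord leq_subr.
    rewrite exprZn -scalerAl -scalerAr -exprD scalerA subnK //.
    exact: ltnW.
  rewrite -scaler_suml exprZn -scalerDl.
  rewrite [X in _ + X](_ : _ = \sum_(1 <= i < m.+1) a i * x ^+ (m - i)).
    by rewrite eqx scale0r.
  rewrite big_add1 big_mkord (reindex_inj rev_ord_inj) /=.
  apply: eq_bigr => i _; rewrite subKn //.
rewrite /root => /eqP px0.
have p_neq0 := monic_neq0 p_monic.
set m := (size p).-1.
have szp : size p = m.+1 by rewrite /m polySpred.
(* Conversely, only the coefficient of [T^m] is kept, where [m] is the degree of [p]: the leading
   term then contributes [x ^+ m]. *)
have := congr1 (fun q : {poly R} => q`_m) px0.
rewrite -[p in map_poly _ p]coefK poly_def rmorph_sum horner_sum coef_sum coef0 /=.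
rewrite szp big_ord_recr /= => eqm.
have lead1 : p`_m = 1 by have /monicP := p_monic.
have coef_term (i : nat) : (i <= m)%N ->
    (map_poly iota (p`_i *: 'X^i)).[x *: 'X]`_m
      = (iota p`_i)`_(m - i) * x ^+ i.
  move=> le_im; rewrite linearZ /= map_polyXn hornerZ hornerXn exprZn.
  by rewrite -scalerAr coefZ coefMXn ltnNge le_im /= mulrC.
exists m, (fun i => (iota p`_(m - i))`_i); split.
- rewrite lt0n; apply/eqP => m0; move: eqm; rewrite coef_term // lead1 rmorph1.
  rewrite m0 big_ord0 add0r expr0 mulr1 coef1 /= => /eqP.
  by rewrite oner_eq0.
- by move=> i _; apply: iotaP.
rewrite -[RHS]eqm [RHS]addrC; congr (_ + _).
  by rewrite coef_term // lead1 rmorph1 subnn coef1 mul1r.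
rewrite big_add1 big_mkord (reindex_inj rev_ord_inj) /=.
apply: eq_bigr => i _; rewrite coef_term; last exact: ltnW.
by rewrite subnSK // subKn // ltnW.
Qed.

Lemma rees_subring_closed : subring_closed rees_pred.
Proof.
split.
- apply/rees_predP => -[|i]; first by rewrite filt0.
  by rewrite coef1; apply: filt_zero.
- move=> p q /rees_predP Fp /rees_predP Fq; apply/rees_predP => i.
  by rewrite coefB; apply: filtB.
- move=> p q /rees_predP Fp /rees_predP Fq; apply/rees_predP => i.
  rewrite coefM; apply: filt_sum => j _.
  by rewrite -[X in F X](subnKC (ltnSE (ltn_ord j))); apply: filtM.
Qed.

HB.instance Definition _ :=
  GRing.isSubringClosed.Build {poly R} rees_pred rees_subring_closed.

(** The Rees algebra as a ring of its own, whose inclusion [val] into [{poly R}] is the morphism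
    over which integrality is taken. *)
Record rees := Rees { rees_val : {poly R}; rees_valP : rees_val \in rees_pred }.

HB.instance Definition _ := [isSub for rees_val].
HB.instance Definition _ := [Choice of rees by <:].
HB.instance Definition _ := [SubChoice_isSubComNzRing of rees by <:].

(** Sums of elements integral over a ring are integral; this is applied to [x T] and [y T] over the
    Rees algebra. *)
Lemma integral_filtD x y :
  integral_filt x -> integral_filt y -> integral_filt (x + y).
Proof.
have inteq := @integral_filtE rees val.
have valF (p : rees) i : F i (val p)`_i by have /rees_predP := valP p.
have val_onto (q : {poly R}) : (forall i, F i q`_i) -> exists p : rees, val p = q.
  by move=> /rees_predP Fq; exists (Rees Fq).
rewrite !(inteq valF val_onto) scalerDl; exact: integral_add.
Qed.

Lemma integral_filt0 : integral_filt 0.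
Proof.
exists 1%N, (fun=> 0); split=> // [i _|]; first exact: filt_zero.
by rewrite expr1 big_nat1 mul0r addr0.
Qed.

Lemma integral_filtX N x : (0 < N)%N ->
  F N (x ^+ N) -> integral_filt x.
Proof.
move=> N_gt0 Hx.
exists N, (fun i => if i == N then - x ^+ N else 0); split=> // [i _|].
  case: eqP => [-> | _]; last exact: filt_zero.
  by rewrite -sub0r; apply: filtB => //; apply: filt_zero.
rewrite big_nat_recr //= eqxx subnn mulr1 big_nat big1 ?add0r ?subrr //.
by move=> i /andP[_ lt_iN]; rewrite ltn_eqF // mul0r.
Qed.

End Rees.

(** * Spans, and monomial ideals as sets of exponents *)

Section IdealSpan.
Variable R : comNzRingType.
Implicit Types (S T : set R).

Lemma ideal_span_min S T : T 0 -> (forall x y, T x -> T y -> T (x + y)) ->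
  (forall c x, T x -> T (c * x)) -> S `<=` T -> ideal_span S `<=` T.
Proof.
move=> T0 TD TM ST f [s [Ss ->]]; rewrite big_seq.
by elim/big_ind: _ => // c /Ss /ST /TM.
Qed.

Lemma ideal_span_id S : S `<=` ideal_span S.
Proof.
move=> f Sf; exists [:: (1, f)]; split; last by rewrite big_seq1 mul1r.
by move=> c; rewrite inE => /eqP ->.
Qed.

Lemma ideal_spanM S c f : ideal_span S f -> ideal_span S (c * f).
Proof.
move=> [s [Ss ->]]; exists [seq (c * x.1, x.2) | x <- s]; split.
  by move=> _ /mapP[x /Ss Sx ->].
by rewrite big_map mulr_sumr; apply: eq_bigr => x _; rewrite mulrA.
Qed.

Lemma ideal_spanD S f g : ideal_span S f -> ideal_span S g ->
  ideal_span S (f + g).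
Proof.
move=> [s [Ss ->]] [t [St ->]]; exists (s ++ t); split; last by rewrite big_cat.
by move=> c; rewrite mem_cat => /orP[/Ss | /St].
Qed.

Lemma ideal_span0 S : ideal_span S 0.
Proof. by exists [::]; rewrite big_nil. Qed.

End IdealSpan.

Section MonomialIdeal.
Variables (n : nat) (K : fieldType).
Implicit Types (U V W G : set 'X_{1..n}) (p q : {mpoly K[n]}).
Implicit Types (a b g m : 'X_{1..n}).

Definition upset G : set 'X_{1..n} :=
  [set m | exists2 g, G g & (g <= m)%MM].

Definition nfold G (k : nat) : set 'X_{1..n} :=
  [set m | exists s : seq 'X_{1..n},
     [/\ size s = k, forall g, g \in s -> G g & m = (\sum_(g <- s) g)%MM]].

(** The [K]-span of the monomials with exponent in [U]. It is an ideal once [U] is up-closed, and it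
    turns statements on monomial ideals into statements on exponents. *)
Definition mideal U : set {mpoly K[n]} :=
  [set f | forall m, m \in msupp f -> U m].

Definition up_closed U := forall a b, U a -> (a <= b)%MM -> U b.

Lemma upset_up G : up_closed (upset G).
Proof. by move=> a b [g Gg le_ga] le_ab; exists g => //; apply: lepm_trans le_ab. Qed.

Lemma upset_id G : G `<=` upset G.
Proof. by move=> g Gg; exists g => //; apply: lepm_refl. Qed.

Lemma lepm_add a b a' b' :
  (a <= a')%MM -> (b <= b')%MM -> (a + b <= a' + b')%MM.
Proof.
move=> /mnm_lepP la /mnm_lepP lb; apply/mnm_lepP => i.
by rewrite !mnmDE leq_add.
Qed.

Lemma nfoldD G i j a b : nfold G i a -> nfold G j b -> nfold G (i + j) (a + b)%MM.
Proof.
move=> [s [<- Gs ->]] [t [<- Gt ->]]; exists (s ++ t); split.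
- exact: size_cat.
- by move=> g; rewrite mem_cat => /orP[/Gs | /Gt].
- by rewrite big_cat.
Qed.

Lemma nfold0 G : nfold G 0 0%MM.
Proof. by exists [::]; rewrite big_nil. Qed.

Lemma nfold1 G g : G g -> nfold G 1 g.
Proof.
move=> Gg; exists [:: g]; rewrite big_seq1; split => // h.
by rewrite inE => /eqP ->.
Qed.

Lemma nfoldMn G g k : G g -> nfold G k (g *+ k)%MM.
Proof.
move=> Gg; elim: k => [|k IHk]; first by rewrite mulm0n; apply: nfold0.
by rewrite mulmS -add1n; apply: nfoldD => //; apply: nfold1.
Qed.

Lemma mdeg_nfold G d k m : (forall g, G g -> mdeg g = d) ->
  nfold G k m -> mdeg m = (d * k)%N.
Proof.
move=> Gd [s [<- Gs ->]]; rewrite mdeg_sum big_seq.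
rewrite (eq_bigr (fun=> d)); last by move=> g /Gs /Gd.
by rewrite -big_seq big_const_seq count_predT iter_addn addn0.
Qed.

Lemma upset_nfoldD G i j a b : upset (nfold G i) a -> upset (nfold G j) b ->
  upset (nfold G (i + j)) (a + b)%MM.
Proof.
move=> [g Gg lg] [h Gh lh]; exists (g + h)%MM; first exact: nfoldD.
exact: lepm_add.
Qed.

Lemma upset_nfoldS G i j a : (i <= j)%N -> upset (nfold G j) a ->
  upset (nfold G i) a.
Proof.
move=> le_ij [_ [s [szs Gs ->]] le_sa]; exists (\big[+%MM/0%MM]_(g <- take i s) g).
  exists (take i s); split=> //; first by rewrite size_takel // szs.
  by move=> g /mem_take /Gs.
by apply: lepm_trans le_sa; rewrite -[s in X in (_ <= X)%MM](cat_take_drop i) big_cat lem_addr.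
Qed.

Lemma mideal0 U : mideal U 0.
Proof. by move=> m; rewrite msupp0. Qed.

Lemma midealB U p q : mideal U p -> mideal U q -> mideal U (p - q).
Proof.
by move=> Uf Ug m /msuppB_le; rewrite mem_cat => /orP[/Uf | /Ug].
Qed.

Lemma midealD U p q : mideal U p -> mideal U q -> mideal U (p + q).
Proof.
by move=> Uf Ug m /msuppD_le; rewrite mem_cat => /orP[/Uf | /Ug].
Qed.

Lemma midealM U V W p q : (forall a b, U a -> V b -> W (a + b)%MM) ->
  mideal U p -> mideal V q -> mideal W (p * q).
Proof.
by move=> UVW Uf Vg _ /msuppM_le /allpairsP[[a b] [/Uf Ua /Vg Vb ->]]; apply: UVW.
Qed.

Lemma midealX U m : mideal U 'X_[m] <-> U m.
Proof.
split=> [| Um b]; first by apply; rewrite msuppX inE.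
by rewrite msuppX inE => /eqP ->.
Qed.

Lemma mideal_mull U p q : up_closed U -> mideal U p -> mideal U (q * p).
Proof.
move=> U_up; apply: (@midealM setT) => // a b _ /U_up; apply; exact: lem_addl.
Qed.

Lemma mideal_min U (T : set {mpoly K[n]}) : T 0 ->
  (forall x y, T x -> T y -> T (x + y)) ->
  (forall c m, U m -> T (c *: 'X_[m])) -> mideal U `<=` T.
Proof.
move=> T0 TD TX f Uf; rewrite [f]mpolyE big_seq.
by elim/big_ind: _ => // m /Uf; apply: TX.
Qed.

Lemma monomial_spanE G : monomial_span G = mideal (upset G) :> set {mpoly K[n]}.
Proof.
apply/seteqP; split.
  apply: ideal_span_min; [exact: mideal0 | exact: midealD | |].
    by move=> c x; apply: mideal_mull; exact: upset_up.
  by move=> _ [m Gm <-]; apply/midealX/upset_id.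
apply: mideal_min; [exact: ideal_span0 | exact: ideal_spanD |].
move=> c m [g Gg le_gm]; rewrite -mul_mpolyC -(submK le_gm) mpolyXD mulrA.
by apply/ideal_spanM/ideal_span_id; exists g.
Qed.

Lemma ideal_powE G k :
  ideal_pow (mideal (upset G)) k = mideal (upset (nfold G k)).
Proof.
apply/seteqP; split.
  apply: ideal_span_min; [exact: mideal0 | exact: midealD | |].
    by move=> c x; apply: mideal_mull; exact: upset_up.
  move=> _ [g [Gg ->]]; elim: k g Gg => [|k IHk] g Gg.
    rewrite big_ord0 -mpolyX0; apply/midealX/upset_id/nfold0.
  rewrite big_ord_recl; apply: midealM (Gg ord0) (IHk _ _) => // a b [c Gc lca].
  by apply: (@upset_nfoldD G 1); exists c => //; apply: nfold1.
apply: mideal_min; [exact: ideal_span0 | exact: ideal_spanD |].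
move=> c m [_ [s [szs Gs ->]] le_gm].
rewrite -mul_mpolyC -(submK le_gm) mpolyXD mulrA.
apply/ideal_spanM/ideal_span_id.
exists (fun i => 'X_[nth 0%MM s i]); split.
  by move=> i; apply/midealX/upset_id/Gs/mem_nth; rewrite szs.
by rewrite -mpolyX_prod (big_nth 0%MM) szs big_mkord.
Qed.

End MonomialIdeal.

(** * Extremal choices and Dickson's lemma *)

Section Dickson.
Local Open Scope nat_scope.

Lemma nat_arg_min (T : Type) (P : T -> Prop) (f : T -> nat) :
  (exists x, P x) -> exists2 x, P x & forall y, P y -> f x <= f y.
Proof.
move=> [x0 Px0]; have [m] := ubnP (f x0).
elim: m x0 Px0 => // m IHm x Px /ltnSE le_fx.
have [[y [Py lt_yx]] | noy] := pselect (exists y, P y /\ f y < f x).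
  by apply: (IHm y) => //; apply: leq_trans le_fx.
exists x => // y Py; rewrite leqNgt; apply/negP => lt_yx.
by apply: noy; exists y.
Qed.

Lemma nat_arg_max (T : Type) (P : T -> Prop) (f : T -> nat) (b : nat) :
  (exists x, P x) -> (forall x, P x -> f x <= b) ->
  exists2 x, P x & forall y, P y -> f y <= f x.
Proof.
move=> exP fb; have [x Px xmin] := nat_arg_min (fun x => b - f x) exP.
exists x => // y Py; have := xmin y Py; have := fb x Px; have := fb y Py; lia.
Qed.

(** Each index is chosen to minimize [u] among all indices beyond the previous one. The minima are
    over shrinking ranges, so they do not decrease. *)
Lemma nondecreasing_subseq (u : nat -> nat) :
  exists phi : nat -> nat,
    {homo phi : i j / i < j} /\ {homo u \o phi : i j / i <= j}.
Proof.
have /choice [A AP] k : exists i, k <= i /\ forall j, k <= j -> u i <= u j.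
  have [| i] := @nat_arg_min nat (fun i => k <= i) u; first by exists k.
  by exists i.
pose phi i := iter i (fun k => A k.+1) (A 0).
have phiS i : phi i < phi i.+1 by have [] := AP (phi i).+1.
exists phi; split; first exact: (homo_ltn ltn_trans phiS).
apply: (homo_leq leqnn leq_trans) => i /=.
case: i => [|i]; first by have [_] := AP 0; apply.
have [_] := AP (phi i).+1; apply; exact: ltn_trans (phiS i) (phiS i.+1).
Qed.

(** Extracting a subsequence once for each coordinate makes all coordinates nondecreasing; its first
    two terms are then comparable. *)
Lemma dickson (T : finType) (u : nat -> T -> nat) :
  exists i j, i < j /\ forall t, u i t <= u j t.
Proof.
suff [phi [phi_lt phi_u]] : exists phi : nat -> nat,
    {homo phi : i j / i < j} /\
    forall t, t \in enum T -> {homo (fun i => u (phi i) t) : i j / i <= j}.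
  exists (phi 0), (phi 1); split; first exact: phi_lt.
  by move=> t; apply: phi_u; rewrite ?mem_enum.
elim: (enum T) => [|t s [phi [phi_lt phi_u]]]; first by exists id; split.
have [psi [psi_lt psi_u]] := nondecreasing_subseq (fun i => u (phi i) t).
exists (phi \o psi); split=> [i j lt_ij | t1]; first exact/phi_lt/psi_lt.
rewrite inE => /predU1P[-> | s_t1] i j le_ij; first exact: psi_u.
by apply: (phi_u t1 s_t1); apply: ltnW_homo le_ij.
Qed.

End Dickson.

(** * The integral closure of a monomial ideal *)

Section NewtonPolyhedron.
Variables (n : nat) (K : fieldType) (G : set 'X_{1..n}) (d : nat).
Hypothesis G_deg : forall g, G g -> mdeg g = d.
Implicit Types (p q : {mpoly K[n]}) (a b g m : 'X_{1..n}).

(** The lattice points of the Newton polyhedron of [G], with [N] as a common denominator of the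
    convex combination. *)
Definition newton : set 'X_{1..n} :=
  [set a | exists2 N, (0 < N)%N & upset (nfold G N) (a *+ N)%MM].

(* Among the representations of [(N + c) a] as a sum of [N] generators plus a
   remainder, Dickson's lemma yields two which are comparable; their difference
   represents a positive multiple of [a]. *)
Lemma newton_limit a c :
  (forall N, upset (nfold G N) (a *+ (N + c))%MM) -> newton a.
Proof.
move=> GN.
have /choice [s sP] N : exists s : seq 'X_{1..n}, [/\ size s = N,
    forall g, g \in s -> G g & (\big[+%MM/0%MM]_(g <- s) g <= a *+ (N + c))%MM].
  by have [_ [s [szs Gs ->]] le_s] := GN N; exists s.
(* Multiplicities of the generators, then the remainder in each variable. Generators have degree
   [d], so there are finitely many coordinates. *)
pose u N (t : 'X_{1..n < d.+1} + 'I_n) : nat := match t with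
  | inl g => count_mem (g : 'X_{1..n}) (s N)
  | inr i => ((a *+ (N + c))%MM i - (\big[+%MM/0%MM]_(g <- s N) g) i)%N
  end.
have [i [j [lt_ij le_u]]] := dickson u.
have [szi Gi /mnm_lepP le_i] := sP i; have [szj Gj /mnm_lepP le_j] := sP j.
have /count_subseqP [s' sub_s' perm_s'] g :
    (count_mem g (s i) <= count_mem g (s j))%N.
  have [g_i | /count_memPn -> //] := boolP (g \in s i).
  have g_d : (mdeg g < d.+1)%N by rewrite (G_deg (Gi g g_i)).
  exact: le_u (inl (BMultinom g_d)).
(* [r] lists the [j - i] generators left in [s j] once those of [s i] are removed; the shift [c]
   cancels in the difference. *)
have [r perm_r] := perm_to_subseq sub_s'.
have {s' sub_s' perm_s' perm_r} perm_r : perm_eq (s j) (s i ++ r).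
  by apply: perm_trans perm_r _; rewrite perm_cat2r perm_sym.
exists (j - i)%N; first by rewrite subn_gt0.
exists (\big[+%MM/0%MM]_(g <- r) g).
  exists r; split=> //.
    by have := perm_size perm_r; rewrite size_cat szi szj => ->; rewrite addKn.
  by move=> g g_r; apply: Gj; rewrite (perm_mem perm_r) mem_cat g_r orbT.
apply/mnm_lepP => x; have := le_u (inr x); rewrite /u.
have := le_i x; have := le_j x.
rewrite (perm_big _ perm_r) big_cat /= mnmDE !mulmnE mulnBr !mulnDr.
have : (a x * i <= a x * j)%N by rewrite leq_mul2l (ltnW lt_ij) orbT.
lia.
Qed.

Local Notation F k := (mideal (upset (nfold G k)) : set {mpoly K[n]}).

Lemma nfold_filt0 : F 0%N = setT.
Proof.
apply/seteqP; split=> // p _ m _; exists 0%MM; first exact: nfold0.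
by apply/mnm_lepP => i; rewrite mnm0E.
Qed.

Definition nfold_filtration : filtration {mpoly K[n]} :=
  @Filtration _ (fun k => F k) nfold_filt0
    (fun k => @midealB n K (upset (nfold G k)))
    (fun i j p q => midealM (@upset_nfoldD n G i j) (p := p) (q := q))
    (fun k => @mideal0 n K (upset (nfold G k))).

Lemma integral_closure_filt :
  integral_closure (mideal (upset G) : set {mpoly K[n]}) = integral_filt nfold_filtration.
Proof.
apply/seteqP; split=> p [m [a [m_gt0 Fa eqp]]]; exists m, a; split=> // i im.
  by have := Fa i im; rewrite ideal_powE.
by rewrite ideal_powE; apply: Fa.
Qed.

Lemma newton_integral c a : newton a -> integral_filt nfold_filtration (c *: 'X_[a]).
Proof.
move=> [N N_gt0 Ga]; apply: (@integral_filtX _ _ N) => //=.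
rewrite exprZn mpolyXn -mul_mpolyC; apply: mideal_mull; first exact: upset_up.
exact/midealX.
Qed.

(** By induction [p ^+ k] lies in [F (k - m)]: replace a factor [p ^+ m] by the terms
    [a i * p ^+ (m - i)] up to sign, and use that [p ^+ (k - i)] lies in [F (k - i - m)]. *)
Lemma filt_integral_pow p (m : nat) (a : nat -> {mpoly K[n]}) N :
  (forall i, (0 < i <= m)%N -> F i (a i)) ->
  p ^+ m + \sum_(1 <= i < m.+1) a i * p ^+ (m - i) = 0 ->
  F N (p ^+ (N + m)).
Proof.
move=> Fa /eqP; rewrite addr_eq0 => /eqP eqp.
have FW i j x : (i <= j)%N -> F j x -> F i x.
  by move=> le_ij Fx b /Fx; apply: upset_nfoldS.
suff H k : F (k - m)%N (p ^+ k) by rewrite -[N in F N](addnK m).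
have [b] := ubnP k; elim: b k => // b IHb k /ltnSE le_kb.
have [le_mk | lt_km] := leqP m k; last first.
  by rewrite (_ : (k - m)%N = 0%N) ?nfold_filt0 //; lia.
rewrite -{2}(subnK le_mk) exprD eqp mulrN mulr_sumr -sub0r.
apply: (filtB (f := nfold_filtration)); first exact: mideal0.
rewrite big_nat; apply: (@filt_sum _ nfold_filtration) => i im /=.
rewrite mulrCA -exprD.
(* Only an inequality, since [k - i - m] is truncated at 0. *)
apply: (FW _ (i + (k - m + (m - i) - m))%N); first lia.
apply: (filtM (f := nfold_filtration)); first exact: Fa.
apply: IHb; lia.
Qed.

(** The leading exponent of [p ^+ (N + m)] is [N + m] times that of [p], and it lies in the [N]-th
    power for every [N], with [m] fixed. *)
Lemma mlead_newton p : p != 0 -> integral_filt nfold_filtration p ->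
  newton (mlead p).
Proof.
move=> p_neq0 [m [a [_ Fa eqp]]]; apply: (@newton_limit _ m) => N.
apply: (filt_integral_pow Fa eqp).
by rewrite -mleadX // mlead_supp // expf_neq0.
Qed.

(** The leading term of an integral [p] is itself integral. Subtracting it leaves an integral
    polynomial with fewer monomials, whence an induction on the size of the support. *)
Lemma integral_closure_mideal :
  integral_closure (mideal (upset G) : set {mpoly K[n]}) = mideal newton.
Proof.
rewrite integral_closure_filt; apply/seteqP; split; last first.
  apply: mideal_min; [exact: integral_filt0 | exact: integral_filtD |].
  by move=> c m; apply: newton_integral.
move=> p; have [b] := ubnP (size (msupp p)); elim: b p => // b IHb p le_pb int_p.
have [-> | p_neq0] := eqVneq p 0; first exact: mideal0.
have lead_p := mlead_newton p_neq0 int_p.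
rewrite -[p](subrK (mleadc p *: 'X_[mlead p])); apply: midealD; last first.
  by move=> m /msuppZ_le; rewrite msuppX inE => /eqP ->.
apply: IHb; last first.
  rewrite -scaleNr; apply: integral_filtD => //; exact: newton_integral.
rewrite (perm_size (msupp_rem _ _)) size_rem ?mlead_supp //.
move: le_pb; rewrite ltnS; apply: leq_trans.
by rewrite prednK // lt0n size_eq0 msupp_eq0.
Qed.

End NewtonPolyhedron.

(** * Prime colon ideals of monomial ideals in terms of exponents *)

Lemma prime_idealP (R : comNzRingType) (P : set R) : prime_ideal P <->
  [/\ P 0, ~ P 1, forall c x y, P x -> P y -> P (c * x + y) &
      forall x y, P (x * y) -> P x \/ P y].
Proof.
have in_P x : x \in [pred x | x \in P] <-> P x.
  by split=> [| Px]; [exact: set_mem | exact: mem_set].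
split=> [[[/in_P P0 nP1 PD] Pprime] | [P0 nP1 PD Pprime]].
  split=> // [/in_P P1 | c x y /in_P Px /in_P Py | x y /in_P Pxy].
  - by rewrite P1 in nP1.
  - exact/in_P/PD.
  by have /orP[/in_P | /in_P] := Pprime x y Pxy; [left | right].
split; first split.
- exact/in_P.
- exact/negP/in_P.
- by move=> c x y /in_P Px /in_P Py; apply/in_P/PD.
by move=> x y /in_P /Pprime[/in_P -> // | /in_P ->]; rewrite orbT.
Qed.

Section VNumber.
Variables (n : nat) (K : fieldType).
Implicit Types (U G : set 'X_{1..n}) (p q : {mpoly K[n]}).
Implicit Types (a b g m : 'X_{1..n}) (V : set 'I_n).

(** [mideal (meets V)] is the ideal generated by the variables in [V]. *)
Definition meets V : set 'X_{1..n} :=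
  [set m | exists2 i, V i & (0 < m i)%N].

Lemma meetsD V a b : meets V (a + b)%MM <-> meets V a \/ meets V b.
Proof.
split=> [[i Vi] | [[i Vi lt_i]|[i Vi lt_i]]]; last 2 first.
- by exists i; rewrite // mnmDE addn_gt0 lt_i.
- by exists i; rewrite // mnmDE addn_gt0 lt_i orbT.
by rewrite mnmDE addn_gt0 => /orP[? | ?]; [left | right]; exists i.
Qed.

(** The kernel of this substitution is the ideal generated by the variables in [V], which is
    therefore prime. *)
Definition kill_vars V : n.-tuple {mpoly K[n]} :=
  [tuple if `[< V i >] then 0 else 'X_i | i < n].

Lemma kill_varsX V m :
  'X_[m] \mPo kill_vars V = if `[< meets V m >] then 0 else 'X_[m].
Proof.
rewrite comp_mpolyX; case: asboolP => [[i Vi lt_i] | Vm].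
  rewrite (bigD1 i) //= tnth_mktuple (asboolT Vi) expr0n.
  by rewrite -[(_ == 0)%N]negbK -lt0n lt_i mul0r.
rewrite [RHS]mpolyXE_id; apply: eq_bigr => i _; rewrite tnth_mktuple.
case: asboolP => // Vi; case: (posnP (m i)) => [-> | lt_i].
  by rewrite !expr0.
by case: Vm; exists i.
Qed.

Lemma kill_vars_eq0 V p : p \mPo kill_vars V = 0 <-> mideal (meets V) p.
Proof.
have coeffE m : (p \mPo kill_vars V)@_m = if `[< meets V m >] then 0 else p@_m.
  elim/mpolyind: p => [|c b p _ _ IHp].
    by rewrite comp_mpoly0 mcoeff0; case: ifP.
  rewrite comp_mpolyD comp_mpolyZ kill_varsX !mcoeffD IHp !mcoeffZ mcoeffX.
  have [-> | ne_bm] := eqVneq b m.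
    by case: asboolP; rewrite ?mcoeff0 ?mcoeffX ?eqxx ?mulr0 ?addr0.
  by do 2 case: asboolP; rewrite ?mcoeff0 ?mcoeffX ?(negPf ne_bm) ?mulr0 ?add0r.
split=> [p0 m p_m | Vp]; last first.
  apply/mpolyP => m; rewrite coeffE mcoeff0; case: asboolP => // Vm.
  by apply/eqP; rewrite mcoeff_eq0; apply/negP => /Vp.
have := coeffE m; rewrite p0 mcoeff0; case: asboolP => // _ /esym/eqP.
by rewrite mcoeff_eq0 p_m.
Qed.

Lemma prime_meets V : prime_ideal (mideal (meets V) : set {mpoly K[n]}).
Proof.
apply/prime_idealP; split=> [|/(_ 0%MM)|c p q Vp Vq|p q].
- exact: mideal0.
- by rewrite msupp1 inE eqxx => /(_ isT) [i _]; rewrite mnm0E.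
- apply: midealD => //; apply: (@midealM _ _ setT (meets V)) Vp => //.
  by move=> a b _ Vb; apply/meetsD; right.
move=> /kill_vars_eq0 /eqP; rewrite rmorphM /= mulf_eq0.
by move=> /orP[] /eqP /kill_vars_eq0; [left | right].
Qed.

(* For an up-closed [U], this says that the colon ideal of the monomial ideal
   of [U] by the monomial [a] is generated by variables. *)
Definition prime_colon U a :=
  forall b, U (a + b)%MM -> exists2 i, (0 < b i)%N & U (a + U_(i))%MM.

Lemma prime_colon_v_degree U a : up_closed U -> prime_colon U a ->
  v_degrees (mideal U : set {mpoly K[n]}) (mdeg a).
Proof.
move=> U_up aP; pose V : set 'I_n := [set i | U (a + U_(i))%MM].
have colonE : colon (mideal U) 'X_[a] = mideal (meets V) :> set {mpoly K[n]}.
  apply/seteqP; split=> p Up m.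
    move=> p_m; have [|i lt_i Ui] := aP m; last by exists i.
    by apply: Up; rewrite (perm_mem (msuppMX _ _)) map_f.
  rewrite (perm_mem (msuppMX _ _)) => /mapP[b /Up [i Vi lt_i] ->].
  apply: (U_up _ _ Vi); apply: lepm_add (lepm_refl _) _.
  by rewrite lep1mP -lt0n.
exists 'X_[a], (mideal (meets V)); split=> //; first by rewrite dhomogX.
by split; [exact: prime_meets | exists 'X_[a]].
Qed.

(** Some monomial [a] of [f] has all monomials of its colon ideal in [P]. Otherwise each [a] in the
    support has a multiplier [b] outside [P] with [a + b] in [U]; the product of these [b] is
    outside the prime [P], yet it multiplies [f] into the ideal. *)
Lemma v_degree_prime_colon U e : up_closed U ->
  v_degrees (mideal U : set {mpoly K[n]}) e ->
  exists2 a, mdeg a = e & prime_colon U a.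
Proof.
move=> U_up [f [P [f_homog [/prime_idealP[P0 nP1 _ P_prod] _] colonE]]].
have P_colon p : P p <-> mideal U (p * f) by rewrite -colonE.
suff [a f_a aP] : exists2 a, a \in msupp f &
    forall b, U (a + b)%MM -> P 'X_[b].
  exists a => [|b /aP]; first exact: (dhomogP _ _ _ f_homog a f_a).
  (* The ideal is monomial, so it contains every term of ['X_i * f]. *)
  have PX i : P 'X_i -> U (a + U_(i))%MM.
    move=> /P_colon; apply; rewrite mulrC (perm_mem (msuppMX _ _)) addmC.
    exact: map_f.
  rewrite mpolyXE_id => Pb.
  have : exists2 i, (0 < b i)%N & P 'X_i.
    elim: (index_enum _) Pb => [|i s IHs]; first by rewrite big_nil.
    rewrite big_cons => /P_prod[Pi | /IHs //].
    case bi: (b i) Pi => [|k]; first by rewrite expr0.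
    exists i; first by rewrite bi.
    elim: k {bi} Pi => [|k IHk]; first by rewrite expr1.
    by rewrite exprS => /P_prod[].
  by move=> [i lt_i /PX]; exists i.
apply: contrapT => no_a.
have [q nPq Uq] : exists2 q, ~ P q &
    forall a, a \in msupp f -> mideal U ('X_[a] * q).
  suff: forall s : seq 'X_{1..n}, {subset s <= msupp f} ->
      exists2 q, ~ P q & forall a, a \in s -> mideal U ('X_[a] * q).
    exact.
  elim=> [_|a s IHs sub_s]; first by exists 1.
  have [|q nPq Uq] := IHs; first by move=> b s_b; apply: sub_s; rewrite inE s_b orbT.
  have [b Uab nPb] : exists2 b, U (a + b)%MM & ~ P 'X_[b].
    apply: contrapT => no_b; apply: no_a; exists a; first exact: sub_s (mem_head _ _).
    by move=> b Uab; apply: contrapT => nPb; apply: no_b; exists b.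
  exists ('X_[b] * q); first by move=> /P_prod[].
  move=> c; rewrite inE => /predU1P[-> | s_c].
    rewrite mulrA -mpolyXD mulrC; apply: mideal_mull => //; exact/midealX.
  by rewrite mulrCA; apply: mideal_mull => //; apply: Uq.
apply: nPq; apply/P_colon; rewrite mulrC [f]mpolyE mulr_suml big_seq.
elim/big_ind: _ => [|x y|a f_a]; [exact: mideal0 | exact: midealD |].
rewrite -scalerAl => m /msuppZ_le; exact: Uq.
Qed.

(** Take [a] outside [U] with the most variables in its colon ideal, and a counterexample [b] of
    least degree. Removing a variable [i] from [b] gives [c]: either [c] is a smaller
    counterexample, or [a + c] is outside [U] and its colon ideal gains the variable [i]. *)
Lemma exists_prime_colon U : up_closed U -> ~ U 0%MM -> exists a, prime_colon U a.
Proof.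
move=> U_up nU0; pose S a := [set i | `[< U (a + U_(i))%MM >] ]%SET.
have [||a nUa max_a] := @nat_arg_max _ (fun a => ~ U a) (fun a => #|S a|) n.
- by exists 0%MM.
- by move=> a _; rewrite -[X in (_ <= X)%N]card_ord max_card.
exists a => b0 Ub0.
apply: contrapT => no_i.
pose Q b := U (a + b)%MM /\ ~ (exists2 i, (0 < b i)%N & U (a + U_(i))%MM).
have [|b [Ub Sb] min_b] := @nat_arg_min _ Q (@mdeg n); first by exists b0.
have [i lt_i] : exists i, (0 < b i)%N.
  apply: contrapT => nob; apply: nUa; rewrite -[a]addm0.
  rewrite (_ : 0%MM = b) //; apply/mnmP => i; rewrite mnm0E.
  by apply/esym/eqP; rewrite -leqn0 leqNgt; apply/negP => lt_i; apply: nob; exists i.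
have le_ib : (U_(i) <= b)%MM by rewrite lep1mP -lt0n.
set c := (b - U_(i))%MM; have b_eq : b = (c + U_(i))%MM by rewrite submK.
have [Uc | nUc] := pselect (U (a + c)%MM).
  have : (mdeg b <= mdeg c)%N.
    apply: min_b; split=> // -[j lt_j Uj]; apply: Sb; exists j => //.
    by rewrite b_eq mnmDE addn_gt0 lt_j.
  by rewrite {1}b_eq mdegD mdeg1 addn1 ltnn.
have := max_a (a + c)%MM nUc; apply/negP; rewrite -ltnNge.
apply/proper_card/properP; split.
  apply/fintype.subsetP => j; rewrite !finset.inE => /asboolP Uj; apply/asboolP.
  by apply: (U_up _ _ Uj); apply: lepm_add (lem_addr _ _) (lepm_refl _).
exists i; rewrite finset.inE; first by apply/asboolP; rewrite -addmA -b_eq.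
by apply/asboolP => Ui; apply: Sb; exists i.
Qed.

End VNumber.

(** * Degree bounds and linear inequalities for equigenerated ideals *)

Section Equigenerated.
Variables (n : nat) (G : set 'X_{1..n}) (d : nat).
Hypothesis G_deg : forall g, G g -> mdeg g = d.
Implicit Types (a b g m : 'X_{1..n}).

Lemma newton_up : up_closed (newton G).
Proof.
move=> a b [N N_gt0 GN] le_ab; exists N => //; apply: upset_up GN _.
by apply/mnm_lepP => i; rewrite !mulmnE leq_mul2r (mnm_lepP le_ab) orbT.
Qed.

Lemma newton_nfold N s a : (0 < N)%N -> nfold G N s ->
  (forall i, s i <= a i * N)%N -> newton G a.
Proof.
move=> N_gt0 Gs le_sa; exists N => //; exists s => //.
by apply/mnm_lepP => i; rewrite mulmnE.
Qed.

Lemma newtonP a : newton G a ->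
  exists N s, [/\ (0 < N)%N, nfold G N s & forall i, (s i <= a i * N)%N].
Proof.
move=> [N N_gt0 [s Gs /mnm_lepP le_sa]]; exists N, s; split=> // i.
by rewrite -mulmnE.
Qed.

Lemma newton_id g : G g -> newton G g.
Proof.
move=> Gg; apply: (@newton_nfold 1 g) => // [|i]; first exact: nfold1.
by rewrite muln1.
Qed.

Lemma mdeg_le a b : (forall i, a i <= b i)%N -> (mdeg a <= mdeg b)%N.
Proof. by move=> le_ab; rewrite !mdegE; apply: leq_sum. Qed.

Lemma newton_mdeg a : newton G a -> (d <= mdeg a)%N.
Proof.
move=> /newtonP[N [s [N_gt0 Gs le_sa]]].
rewrite -(leq_pmul2r N_gt0) -(mdeg_nfold G_deg Gs) -mdegMn; apply: mdeg_le => i.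
by rewrite mulmnE.
Qed.

(** Linear inequalities on the generators bound the Newton polyhedron; [e = 0] gives a bound on a
    single exponent. *)
Lemma nfold_linear_ge (x y : 'I_n) e c N s :
  (forall g, G g -> c <= g x + e * g y)%N -> nfold G N s ->
  (c * N <= s x + e * s y)%N.
Proof.
move=> Gc [t [<- Gt ->]]; elim: t Gt => [|g t IHt] Gt /=; first by rewrite muln0.
rewrite !big_cons !mnmDE mulnS mulnDr addnACA leq_add ?Gc ?IHt //.
  exact/Gt/mem_head.
by move=> h t_h; apply/Gt/mem_behead.
Qed.

Lemma lepm_mdeg_eq a b : (a <= b)%MM -> (mdeg b <= mdeg a)%N -> a = b.
Proof.
move=> /submK b_eq; have := congr1 (@mdeg n) b_eq; rewrite mdegD => bE le_ba.
have /eqP : mdeg (b - a)%MM = 0%N by lia.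
by rewrite mdeg_eq0 => /eqP ba0; rewrite -b_eq ba0 add0m.
Qed.

Lemma upset_mdeg m : mdeg m = d -> upset G m -> G m.
Proof.
by move=> m_d [g Gg le_gm]; rewrite -(lepm_mdeg_eq le_gm) // m_d G_deg.
Qed.

(** A generator, taken as [b], yields a variable whose product with [a] is in the ideal, hence has
    degree at least [d]. *)
Lemma prime_colon_mdeg a : (exists g, G g) -> prime_colon (upset G) a ->
  (d <= (mdeg a).+1)%N.
Proof.
move=> [g Gg] aP; have [|i _ [h Gh le_ha]] := aP g.
  by exists g => //; apply: lem_addl.
rewrite -(G_deg Gh) -addn1 -(mdeg1 i) -mdegD.
exact/mdeg_le/mnm_lepP.
Qed.

Lemma mdeg_gt0 b : (0 < mdeg b)%N -> exists i, (0 < b i)%N.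
Proof.
rewrite lt0n mdeg_eq0 => b0; apply: contrapT => no_i; case/eqP: b0.
apply/mnmP => i; rewrite mnm0E; apply/eqP; rewrite -leqn0 leqNgt.
by apply/negP => lt_i; apply: no_i; exists i.
Qed.

Lemma newton_addr_gt0 a b : (mdeg a < d)%N -> newton G (a + b)%MM ->
  exists i, (0 < b i)%N.
Proof.
move=> lt_ad /newton_mdeg; rewrite mdegD => le_d; apply: mdeg_gt0; lia.
Qed.

End Equigenerated.

(** * Prime colon ideals of the integral closure in three variables *)

Section ThreeVariables.
Variables (G : set 'X_{1..3}) (d : nat).
Hypothesis G_deg : forall g, G g -> mdeg g = d.
Implicit Types (a b g m : 'X_{1..3}).

Lemma ord3_cases (x y z : 'I_3) : x != y -> x != z -> y != z ->
  forall i, [\/ i = x, i = y | i = z].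
Proof.
move=> xy xz yz i.
suff : [|| i == x, i == y | i == z].
  by move=> /or3P[] /eqP; [constructor 1 | constructor 2 | constructor 3].
move: xy xz yz; rewrite -!val_eqE /=.
by case: x y z i => [x ?] [y ?] [z ?] [i ?] /=; lia.
Qed.

Lemma mdeg3 (x y z : 'I_3) m : x != y -> x != z -> y != z ->
  mdeg m = (m x + m y + m z)%N.
Proof.
move=> xy xz yz; rewrite mdegE (bigD1 x) //= (bigD1 y) /=; last by rewrite eq_sym.
rewrite (bigD1 z) /= ?[z == _]eq_sym ?xz // big1 ?addn0 ?addnA // => i.
have [-> | -> | ->] := ord3_cases xy xz yz i; by rewrite eqxx ?andbF.
Qed.

Lemma ord3_third (x y : 'I_3) : exists z : 'I_3, x != z /\ y != z.
Proof.
have [k lt_k3 xyk] : exists2 k, (k < 3)%N & (val x != k) && (val y != k).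
  case: x y => [[|[|[|x]]] ?] [[|[|[|y]]] ?] //=;
  solve [by exists 0%N | by exists 1%N | by exists 2%N].
by exists (Ordinal lt_k3); apply/andP.
Qed.

Lemma prime_colon_newton a : (exists g, G g) -> (mdeg a).+1 = d ->
  prime_colon (upset G) a -> prime_colon (newton G) a.
Proof.
move=> [g0 Gg0] a_d aP b ab_newton.
have [i0 bi0] : exists i, (0 < b i)%N.
  by apply: (newton_addr_gt0 G_deg _ ab_newton); rewrite -a_d.
apply: contrapT => no_i.
have GaU i : upset G (a + U_(i))%MM -> G (a + U_(i))%MM.
  by apply: (upset_mdeg G_deg); rewrite mdegD mdeg1 addn1.
have b0 i : G (a + U_(i))%MM -> b i = 0%N.
  move=> /newton_id Gi; apply/eqP; rewrite -leqn0 leqNgt; apply/negP => lt_i.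
  by apply: no_i; exists i.
have [N [s [N_gt0 Gs le_s]]] := newtonP ab_newton.
have [x gx /GaU Gx] : exists2 i, (0 < g0 i)%N & upset G (a + U_(i))%MM.
  by apply: aP; exists g0 => //; apply: lem_addl.
(* With two variables in the colon ideal, [b] is a power of the third, [z]. *)
have [[y [yx Gy]] | only_x] := pselect (exists y, y != x /\ G (a + U_(y))%MM).
  have [z [xz yz]] := ord3_third x y; have xy : x != y by rewrite eq_sym.
  have bx := b0 x Gx; have bby := b0 y Gy.
  have bz : (0 < b z)%N.
    by have [ix | iy | <- //] := ord3_cases xy xz yz i0; move: bi0;
      rewrite ?ix ?iy ?bx ?bby.
  apply: no_i; exists z => //.
  have := le_s x; have := le_s y.
  rewrite !mnmDE bx bby !addn0 => /subnK; set q := (_ - _)%N => sy.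
  move=> /subnK; set p := (_ - _)%N => sx.
  (* [p] and [q] are what [s] lacks from [N] times [a] in [x] and [y]. The added generators make
     these exponents [p + q + N] times those of [a]; comparing degrees, the exponent of [z] is
     [p + q + N] times [a z + 1]. *)
  apply: (@newton_nfold _ _ (p + q + N)
           ((a + U_(x)) *+ p + (a + U_(y)) *+ q + s)%MM); first lia.
    by apply: nfoldD => //; apply: nfoldD; apply: nfoldMn.
  have := mdeg_nfold G_deg Gs; rewrite -a_d !(@mdeg3 x y z) // => mdeg_s i.
  rewrite !mnmDE !mulmnE !mnmDE !mnm1E.
  have [-> | -> | ->] := ord3_cases xy xz yz i.
  - rewrite eqxx (negPf yx) [z == x]eq_sym (negPf xz); nia.
  - rewrite eqxx (negPf xy) [z == y]eq_sym (negPf yz); nia.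
  - rewrite eqxx (negPf xz) (negPf yz); nia.
(* If [g x <= a x], deleting [x] from [g] gives a multiplier of [a] into the ideal, hence a second
   variable in the colon ideal. So every generator exceeds [a] in [x], which contradicts the bound
   on [s x]. *)
have Gx_gt g : G g -> (a x < g x)%N.
  move=> Gg; rewrite ltnNge; apply/negP => le_gx.
  pose b' := [multinom if i == x then 0%N else g i | i < 3].
  have [|i] := aP b'.
    exists g => //; apply/mnm_lepP => i; rewrite mnmDE mnmE.
    by have [-> | _] := eqVneq i x; [rewrite addn0 | rewrite leq_addl].
  rewrite mnmE; case: eqVneq => // ix _ /GaU Gi; apply: only_x.
  by exists i.
have := @nfold_linear_ge _ G x x 0 (a x).+1 N s; rewrite addn0 => H.
have {H} := H _ Gs; have := le_s x; rewrite mnmDE (b0 x Gx) addn0.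
move=> le_sx H; have : ((a x).+1 * N <= s x)%N.
  by apply: H => g /Gx_gt; rewrite mul0n addn0.
nia.
Qed.

(** Every monomial of degree [d] is integral, so a monomial of degree [d - 1] has the ideal of all
    variables as colon ideal. *)
Lemma newton_pure_powers : (0 < d)%N -> (forall x : 'I_3, G (U_(x) *+ d)%MM) ->
  exists2 a, (mdeg a <= d)%N & prime_colon (newton G) a.
Proof.
move=> d_gt0 GU.
exists (U_(ord0) *+ d.-1)%MM; first by rewrite mdegMn mdeg1 mul1n leq_pred.
set a := (_ *+ _)%MM => b ab_newton.
have a_d : mdeg a = d.-1 by rewrite mdegMn mdeg1 mul1n.
have [|i lt_i] := newton_addr_gt0 G_deg _ ab_newton; first by rewrite a_d; lia.
exists i => //; set m := (a + _)%MM.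
have m_d : mdeg m = d by rewrite mdegD mdeg1 a_d; lia.
(* The [d]-th power of [m] is the product of the generators [x_i^d], each taken [m i] times. *)
pose s := (\big[+%MM/0%MM]_i (U_(i) *+ d *+ m i))%MM.
apply: (@newton_nfold _ G d s) => // [|j].
  rewrite -[X in nfold _ X]m_d mdegE /s.
  by apply: big_ind2 => [|????|k _]; [exact: nfold0 | exact: nfoldD | exact: nfoldMn].
rewrite mnm_sumE (bigD1 j) //= big1 => [|k /negPf kj]; rewrite !mulmnE mnm1E.
  by rewrite eqxx mul1n addn0 mulnC.
by rewrite kj.
Qed.

(** Dividing by [x] a generator of least exponent in [x] leaves a monomial whose colon ideal is
    generated by [x]. *)
Lemma newton_common_variable (x : 'I_3) : (exists g, G g) ->
  (forall g, G g -> 0 < g x)%N ->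
  exists2 a, (mdeg a <= d)%N & prime_colon (newton G) a.
Proof.
move=> exG Gx; have [g Gg min_g] := nat_arg_min (fun g => g x) exG.
have gE : ((g - U_(x)) + U_(x))%MM = g by rewrite submK // lep1mP -lt0n Gx.
exists (g - U_(x))%MM; first by rewrite -(G_deg Gg) mdegB.
move=> b /newtonP[N [s [N_gt0 Gs le_s]]].
exists x; last by rewrite gE; apply: newton_id.
rewrite lt0n; apply/eqP => bx0.
have : (g x * N <= s x + 0 * s x)%N.
  by apply: nfold_linear_ge Gs => h /min_g; rewrite mul0n addn0.
have := le_s x; rewrite mnmDE mnmBE mnm1E eqxx bx0.
have := Gx g Gg; nia.
Qed.

Lemma newton_two_variables (x y z : 'I_3) g h :
  x != y -> x != z -> y != z -> G g -> G h ->
  g y = 0%N -> h x = 0%N -> (h y <= g x)%N ->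
  (forall f, G f -> f x = 0%N -> 0 < f y)%N ->
  (forall f, G f -> f y = 0%N -> g x <= f x)%N ->
  exists2 a, (mdeg a <= d)%N & prime_colon (newton G) a.
Proof.
move=> xy xz yz Gg Gh gy hx le_hg Gxy min_g.
have gx : (0 < g x)%N.
  rewrite lt0n; apply/eqP => gx; have := Gxy g Gg gx; by rewrite gy.
pose a := (g - U_(x) + U_(z))%MM.
have ax : a x = (g x).-1.
  by rewrite !mnmDE mnmBE !mnm1E eqxx eq_sym (negPf xz) addn0 subn1.
have ay : a y = 0%N.
  by rewrite !mnmDE mnmBE !mnm1E gy sub0n eq_sym (negPf yz).
have az : a z = (g z).+1.
  by rewrite !mnmDE mnmBE !mnm1E eqxx (negPf xz) subn0 addn1.
clearbody a; exists a; first by rewrite -(G_deg Gg) !(@mdeg3 x y z) // ax ay az; lia.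
move=> b ab_newton.
case: (posnP (b x)) => [bx | bx]; last first.
  exists x => //; apply: newton_up (newton_id Gg) _; apply/mnm_lepP => i.
  rewrite mnmDE mnm1E; have [-> | -> | ->] := ord3_cases xy xz yz i.
  - by rewrite ax eqxx addn1 prednK.
  - by rewrite gy.
  - by rewrite az; lia.
case: (posnP (b y)) => [bby | bby]; last first.
  exists y => //.
  (* With [p = g x], the [p]-th power of [y a] is divisible by [g^(p-1) h]; in [y] this is
     [h y <= g x]. *)
  apply: (@newton_nfold _ G (g x) (g *+ (g x).-1 + h)%MM) => [//||i].
    by have := nfoldD (nfoldMn (g x).-1 Gg) (nfold1 Gh); rewrite addn1 prednK.
  have := G_deg Gh; rewrite -(G_deg Gg) !(@mdeg3 x y z) // hx gy.
  rewrite !mnmDE mulmnE mnm1E; have [-> | -> | ->] := ord3_cases xy xz yz i.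
  - rewrite ax hx eq_sym (negPf xy); nia.
  - rewrite ay gy eqxx; nia.
  - rewrite az (negPf yz); nia.
have [N [s [N_gt0 Gs le_s]]] := newtonP ab_newton.
(* A generator without [y] has exponent at least [g x] in [x], by minimality; any other contributes
   [g x] through [y]. The product of [a] with a power of [z] violates this inequality. *)
have : (g x * N <= s x + g x * s y)%N.
  apply: nfold_linear_ge Gs => f Gf; have := min_g f Gf.
  case: (f y) => [|k _]; [by move=> /(_ erefl); lia | nia].
have := le_s x; have := le_s y; rewrite !mnmDE ax ay bx bby; nia.
Qed.

Lemma newton_prime_colon : (0 < d)%N -> (exists g, G g) ->
  exists2 a, (mdeg a <= d)%N & prime_colon (newton G) a.
Proof.
move=> d_gt0 exG.
have [[x Gx] | no_x] := pselect (exists x : 'I_3, forall g, G g -> (0 < g x)%N).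
  exact: newton_common_variable Gx.
have G0 x : exists g, G g /\ g x = 0%N.
  apply: contrapT => no_g; apply: no_x; exists x => g Gg; rewrite lt0n.
  by apply/eqP => gx; apply: no_g; exists g.
have [[x [y [xy Gxy]]] | no_xy] := pselect (exists x y : 'I_3, x != y /\
    forall g, G g -> g x = 0%N -> (0 < g y)%N).
  have [z [xz yz]] := ord3_third x y.
  have [g [Gg gy] min_g] := nat_arg_min (fun g => g x) (G0 y).
  have [h [Gh hx] min_h] := nat_arg_min (fun h : 'X_{1..3} => h y) (G0 x).
  case: (leqP (h y) (g x)) => [le_hg | /ltnW le_gh].
    apply: (@newton_two_variables x y z g h) => // f Gf fy.
    by apply: min_g.
  apply: (@newton_two_variables y x z h g) => //; first by rewrite eq_sym.
    move=> f Gf fy; rewrite lt0n; apply/eqP => fx.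
    by have := Gxy f Gf fx; rewrite fy.
  by move=> f Gf fx; apply: min_h.
(* Now no two variables meet all generators: some generator avoids both variables other than [z], so
   it is the [d]-th power of [z]. *)
apply: newton_pure_powers => // z.
have [x [zx _]] := ord3_third z z; have [y [zy xy]] := ord3_third z x.
have [f [Gf fx fy]] : exists f, [/\ G f, f x = 0%N & f y = 0%N].
  apply: contrapT => no_f; apply: no_xy; exists x, y; split=> // f Gf fx.
  by rewrite lt0n; apply/eqP => fy; apply: no_f; exists f.
suff <- : f = (U_(z) *+ d)%MM by [].
have := G_deg Gf; rewrite (mdeg3 f zx zy xy) fx fy => fz.
apply/mnmP => i; rewrite mulmnE mnm1E.
have [-> | -> | ->] := ord3_cases zx zy xy i.
- by rewrite eqxx; lia.
- by rewrite (negPf zx) fx.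
- by rewrite (negPf zy) fy.
Qed.

End ThreeVariables.

(** * Minimal generators and comparison of the v-numbers *)

Section MinimalGenerators.
Variables (n : nat) (K : fieldType).
Implicit Types (I : set {mpoly K[n]}) (G U : set 'X_{1..n}).

Lemma v_number_spec I e : v_degrees I e -> is_v_number I (v_number I).
Proof.
move=> Ie; apply: epsilon_spec.
have [v Iv min_v] := nat_arg_min id (ex_intro _ e Ie).
by exists v.
Qed.

Lemma mideal_inj U V : mideal U = mideal V :> set {mpoly K[n]} -> U = V.
Proof.
move=> UV; apply/seteqP; split=> m Um; apply/(@midealX n K).
  by rewrite -UV; apply/midealX.
by rewrite UV; apply/midealX.
Qed.

(** The exponents minimal for divisibility generate, and each of them belongs to any generating
    subset. This gives access to [equigenerated], which speaks of minimal generating sets only. *)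
Lemma exists_minimal_generators I : monomial_ideal I ->
  exists G, minimal_monomial_generators I G.
Proof.
move=> [G0 ->]; rewrite monomial_spanE.
pose G := [set m | upset G0 m /\ forall a, upset G0 a -> (a <= m)%MM -> a = m].
have upG : upset G = upset G0.
  apply/seteqP; split=> m; first by move=> [g [G0g _] /(upset_up G0g)].
  move=> G0m.
  have [|g [G0g le_gm] min_g] :=
    nat_arg_min (P := fun g => upset G0 g /\ (g <= m)%MM) (@mdeg n).
    by exists m; split=> //; apply: lepm_refl.
  exists g => //; split=> // a G0a le_ag.
  apply: lepm_mdeg_eq => //; apply: min_g; split=> //.
  exact: lepm_trans le_gm.
exists G; split; first by rewrite monomial_spanE upG.
move=> G1 G1G; rewrite monomial_spanE -upG => /mideal_inj G1E.
apply/seteqP; split=> // m Gm.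
have [g G1g le_gm] : upset G1 m by rewrite -G1E; apply: upset_id.
have [_ min_m] := Gm; rewrite -(min_m g) //.
by have [] := G1G g G1g.
Qed.

End MinimalGenerators.

Theorem theorem3p12 (K : fieldType) (d : nat) (I : set {mpoly K[3]})
    (I_proper : ~ I 1%R) (I_monomial : monomial_ideal I)
    (I_equigenerated : equigenerated d I) (k : nat) (k_ge1 : (1 <= k)%N) :
  (v_number (integral_closure (ideal_pow I k)) <= v_number (ideal_pow I k))%N.
Proof.
have [G Gmin] := exists_minimal_generators I_monomial.
have G_deg := I_equigenerated G Gmin.
have [I_eq _] := Gmin; rewrite monomial_spanE in I_eq.
have H_deg m : nfold G k m -> mdeg m = (d * k)%N := mdeg_nfold G_deg (m := m).
rewrite I_eq ideal_powE (integral_closure_mideal K H_deg).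
set H := nfold G k; set J := mideal (upset H); set J' := mideal (newton H).
(* Without generators, both ideals are zero because [k] is positive. *)
have [[g Gg] | no_G] := pselect (exists g, G g); last first.
  suff -> : J' = J by [].
  have H0 m : ~ H m.
    move=> [[|g s] [szs Gs _]]; first by rewrite -szs in k_ge1.
    by apply: no_G; exists g; apply/Gs/mem_head.
  congr mideal; apply/seteqP; split=> [m [N N_gt0 [_ [[|g s] [szs Hs _]] _]]|m [g]].
  - by rewrite -szs in N_gt0.
  - by case: (H0 g); apply/Hs/mem_head.
  - by move=> /H0.
have exH : exists h, H h by exists (g *+ k)%MM; apply: nfoldMn.
have d_gt0 : (0 < d)%N.
  rewrite -(G_deg g Gg) lt0n mdeg_eq0; apply/eqP => g0; apply: I_proper.
  by rewrite I_eq -mpolyX0; apply/midealX/upset_id; rewrite -g0.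
have D_gt0 : (0 < d * k)%N by rewrite muln_gt0 d_gt0.
have nH0 : ~ upset H 0%MM.
  by move=> [h Hh /mnm_lepP /mdeg_le]; rewrite mdeg0 H_deg // leqNgt D_gt0.
(* Some degree is admissible for [J], so its v-number is attained, and by a monomial [a]. *)
have [a0 /(prime_colon_v_degree K (@upset_up 3 H)) v_a0] :=
  exists_prime_colon (@upset_up 3 H) nH0.
have [/(v_degree_prime_colon (@upset_up 3 H))[a a_v aP] _] := v_number_spec v_a0.
have le_v b : prime_colon (newton H) b -> (v_number J' <= mdeg b)%N.
  move=> /(prime_colon_v_degree K (@newton_up 3 H)) vb.
  by have [_ min_v] := v_number_spec vb; apply: min_v.
rewrite -/J in a_v; rewrite -a_v.
have [ge_a | lt_a] := leqP (d * k) (mdeg a).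
  have [b le_b bP] := newton_prime_colon H_deg D_gt0 exH.
  by apply: leq_trans (le_v b bP) _; apply: leq_trans ge_a.
apply: le_v; apply: (prime_colon_newton H_deg exH _ aP).
by apply/eqP; rewrite eqn_leq lt_a; apply: (prime_colon_mdeg H_deg).
Qed.
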